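(* Suppose $c>1$ is a constant such that $g(A)>\log_c|A|$ for all finite Abelian groups $A$. Then for every prime $p\geq c^2$ the following holds: for every $n\ge 1$ and every nonsingular $n\times n$ matrix $M$ over $\mathrm{GF}(p)$ there exists a nowhere zero column vector $x\in \mathrm{GF}(p)^n$ such that $Mx$ is also a nowhere zero vector.
   Context: A vector is nowhere zero if each of its components is nonzero. A subgroup covering of a group $G$ is a collection of subgroups whose union is $G$; it is irredundant if none of its members can be omitted. For a finite group $G$, $g(G)$ denotes the minimal $k$ such that there exists an irredundant covering of $G$ by $k$ subgroups $H_1,\dots,H_k$ for which $\bigcap_i H_i$ is trivial; if no such covering exists, $g(G)=\infty$. *)

(* Defs.v *)
From mathcomp Require Import all_boot all_order all_algebra all_fingroup.
From mathcomp Require Import constructive_ereal reals exp.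

Set Implicit Arguments.
Unset Strict Implicit.
Unset Printing Implicit Defensive.

Import Order.TTheory GRing.Theory Num.Theory.

Section SubgroupCoverings.
Variables (gT : finGroupType) (G : {set gT}).
Implicit Type C : {set {group gT}}.

Definition subgroup_covering C : bool :=
  (C \subset subgroups G) && (\bigcup_(H in C) (H : {set gT}) == G).

Definition irredundant_covering C : bool :=
  subgroup_covering C && [forall H in C, ~~ subgroup_covering (C :\ H)].

(* The minimum over the finite set of admissible coverings. An irredundant
   indexed family has pairwise distinct members, so sets of subgroups lose
   nothing; the unit +oo is the value when no covering is admissible. *)
Definition min_covering (R : realType) : \bar R :=
  (\big[Order.min/+oo%E]_(C : {set {group gT}} |
       irredundant_covering C && (\bigcap_(H in C) (H : {set gT}) == 1%g))
     (#|C|%:R)%:E)%R.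

End SubgroupCoverings.

Local Open Scope ring_scope.

Definition log_base (R : realType) (c x : R) : R := ln x / ln c.

Definition nowhere_zero (F : fieldType) (n : nat) (x : 'cV[F]_n) : Prop :=
  forall i : 'I_n, x i ord0 != 0.

(* Main.v *)
(** If no such [x] exists, the [2n] hyperplanes given by the rows of the
identity and of [M] cover [V = GF(p)^n].  Take an irredundant subcover of [k]
hyperplanes, with intersection [W] of codimension [d]: it induces an
irredundant covering of [V / W] with trivial intersection, so
[k > log_c (p ^ d) >= 2 d].  But if [a] of the hyperplanes come from the
identity and [b] from [M], independence of the rows gives [a <= d] and
[b <= d], whence [k <= a + b <= 2 d]. *)
Require Import Defs.
From mathcomp Require Import all_boot all_order all_algebra all_fingroup.
From mathcomp Require Import constructive_ereal reals exp.
From mathcomp Require Import lra.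

Import Order.TTheory GRing.Theory Num.Theory.
Local Open Scope ring_scope.

Lemma minset_irredundant (gT : finGroupType) (G : {set gT})
    (C : {set {group gT}}) :
  minset (subgroup_covering G) C -> irredundant_covering G C.
Proof.
case/minsetP=> Ccov Cmin; rewrite /irredundant_covering Ccov.
apply/'forall_implyP => H HC; apply/negP => /Cmin/(_ (subD1set _ _)) eqC.
by move: HC; rewrite -eqC setD11.
Qed.

Lemma subgroup_coveringP (gT : finGroupType) (G : {set gT})
    (C : {set {group gT}}) :
  reflect ((forall H : {group gT}, H \in C -> H \subset G) /\
           forall x, x \in G -> exists2 H : {group gT}, H \in C & x \in H)
          (subgroup_covering G C).
Proof.
apply: (iffP andP) => [[/subsetP CG /eqP defG] | [CG Gcov]]; split.
- by move=> H /CG; rewrite inE.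
- by move=> x; rewrite -{1}defG => /bigcupP.
- by apply/subsetP => H /CG; rewrite inE.
rewrite eqEsubset; apply/andP; split; first exact/bigcupsP.
by apply/subsetP => x /Gcov[H HC xH]; apply/bigcupP; exists H.
Qed.

(** Each member of [C] contains [W], so it is the full preimage of its image in [G / W]. A covering
    of [G / W] by fewer images therefore pulls back to a proper subcovering of [G]. *)
Lemma irredundant_covering_quotient (gT : finGroupType) (G W : {group gT})
    (C : {set {group gT}}) :
  irredundant_covering G C -> G \subset ('N(W))%g ->
  (forall H : {group gT}, H \in C -> W \subset H) ->
  irredundant_covering (G / W)%g [set (H / W)%G | H : {group gT} in C].
Proof.
case/andP=> /subgroup_coveringP[CG Gcov] /'forall_implyP Cirr nWG WC.
apply/andP; split.
  apply/subgroup_coveringP; split=> [_ /imsetP[H HC ->]|y].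
    by rewrite quotientS ?CG.
  case/morphimP=> x _ /Gcov[H HC xH] ->; exists (H / W)%G; first exact: imset_f.
  exact: mem_quotient.
apply/'forall_implyP => _ /imsetP[H HC ->]; apply: contra (Cirr _ HC).
case/subgroup_coveringP=> _ Qcov; apply/subgroup_coveringP.
split=> [K /setD1P[_ /CG] // | x xG].
have [Q /setD1P[neqQH /imsetP[K KC defQ]] xQ] := Qcov _ (mem_quotient W xG).
exists K.
  by rewrite !inE KC andbT; apply: contraNneq neqQH => eqKH; rewrite defQ eqKH.
rewrite defQ in xQ.
rewrite -(quotientGK (H := W) (G := K)).
  by rewrite mem_morphpre ?(subsetP nWG).
by rewrite /normal WC // (subset_trans (CG K KC)).
Qed.

(** The images of the members of [C] in [G / W] form an admissible covering: a common element lifts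
    to an element of every member of [C], hence of [W]. *)
Lemma min_covering_quotient (R : realType) (gT : finGroupType)
    (G W : {group gT}) (C : {set {group gT}}) :
  irredundant_covering G C -> G \subset ('N(W))%g ->
  \bigcap_(H in C) (H : {set gT}) = W ->
  (min_covering (G / W)%g R <= (#|C|%:R)%:E)%E.
Proof.
move=> Cirr nWG defW.
have WC (H : {group gT}) : H \in C -> W \subset H.
  by move=> HC; rewrite -defW bigcap_inf.
set D := [set (H / W)%G | H : {group gT} in C].
have Dirr : irredundant_covering (G / W)%g D.
  exact: irredundant_covering_quotient.
apply: (@le_trans _ _ (#|D|%:R)%:E); last first.
  by rewrite lee_fin ler_nat leq_imset_card.
apply: bigmin_le_cond; rewrite Dirr /=.
have /andP[/subgroup_coveringP[CG Gcov] _] := Cirr.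
(* A member of [C] is needed to lift [y]: an empty intersection would be the whole type. *)
have [H0 H0C _] := Gcov _ (group1 G).
apply/eqP/trivgP/subsetP => y /bigcapP yD.
have /morphimP[x nWx xH0 def_y] := yD _ (imset_f _ H0C).
rewrite def_y inE -(coset_id (A := W) (x := x)) //.
rewrite -defW; apply/bigcapP => H HC.
have := yD _ (imset_f _ HC); rewrite def_y => xH.
rewrite -(quotientGK (H := W) (G := H)) ?mem_morphpre //.
by rewrite /normal WC // (subset_trans (CG _ HC)).
Qed.

Section RowHyperplanes.
Variables (F : finFieldType) (n : nat).
Implicit Type N : 'M[F]_n.

Definition row_hyperplane N (i : 'I_n) : {set 'cV[F]_n} :=
  [set x | (N *m x) i 0 == 0].

Fact row_hyperplane_group_set N i : group_set (row_hyperplane N i).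
Proof.
apply/group_setP; split=> [|x y].
  by rewrite inE FinRing.zmod1gE mulmx0 mxE.
rewrite !inE FinRing.zmodMgE mulmxDr => /eqP Nx0 /eqP Ny0.
by rewrite mxE Nx0 Ny0 addr0.
Qed.

Canonical row_hyperplane_group N i := Group (row_hyperplane_group_set N i).

(** Counting replaces a dimension argument: [x] is determined by [N *m x], whose coordinates in [I]
    vanish for [x] in [W]. *)
Lemma card_row_hyperplanes_cap N (W : {set 'cV[F]_n}) (I : {set 'I_n}) :
  N \in unitmx -> (forall i, i \in I -> W \subset row_hyperplane N i) ->
  (#|W| * #|F| ^ #|I| <= #|F| ^ n)%N.
Proof.
move=> Nu WI; pose f (x : 'cV[F]_n) := [ffun i => (N *m x) i 0].
have f_inj : injective f.
  move=> x y /ffunP eqf; apply: (can_inj (mulKmx Nu)); apply/matrixP=> i j.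
  by rewrite ord1; have := eqf i; rewrite !ffunE.
have leW : (#|W| <= #|F| ^ #|~: I|)%N.
  (* The right-hand side counts the functions to [F] that are zero on [I]. *)
  rewrite -(card_pffun_on 0 (mem (~: I)) (mem F)) -(card_imset _ f_inj).
  apply/subset_leq_card/subsetP => _ /imsetP[x xW ->].
  apply/pffun_onP; split=> [|?] //; apply/subsetP => i.
  rewrite !inE ffunE; apply: contra => /WI/subsetP/(_ x xW).
  by rewrite inE.
rewrite -[X in (_ <= _ ^ X)%N](card_ord n) -(cardsC I) addnC expnD.
by rewrite leq_mul2r leW orbT.
Qed.

(** This is the bound [a <= d] in the form [p ^ a <= #|V / W|], so that [d] itself never has to be
    defined. *)
Lemma card_quotient_row_hyperplanes N (W : {group 'cV[F]_n}) (I : {set 'I_n}) :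
  N \in unitmx -> (forall i, i \in I -> W \subset row_hyperplane N i) ->
  (#|F| ^ #|I| <= #|[set: 'cV[F]_n] / W|%g)%N.
Proof.
move=> Nu WI; have := card_row_hyperplanes_cap _ _ _ Nu WI.
have oV : (#|W| * #|[set: 'cV[F]_n] : W|%g)%N = (#|F| ^ n)%N.
  by rewrite Lagrange ?subsetT // cardsT card_mx muln1.
rewrite -oV leq_pmul2l ?cardG_gt0 // card_quotient //.
by rewrite sub_abelian_norm ?FinRing.zmod_abelian ?subsetT.
Qed.

End RowHyperplanes.

Arguments row_hyperplane {F n}.
Arguments row_hyperplane_group {F n}.

(** Take logarithms in [c ^ (2 * a) <= p ^ a <= q]. *)
Lemma log_base_ge_double (R : realType) (c : R) (p a q : nat) :
  1 < c -> c ^+ 2 <= p%:R -> (p ^ a <= q)%N -> a.*2%:R <= log_base c (q%:R).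
Proof.
move=> c1 cp paq; have c0 : 0 < c by lra.
have lnc : 0 < ln c by rewrite ln_gt0.
rewrite /log_base ler_pdivlMr // mulr_natl -muln2 mulnC -lnXn //.
have cpa : c ^+ (2 * a) <= q%:R.
  rewrite exprM; apply: (@le_trans _ _ (p%:R ^+ a)).
    by rewrite lerXn2r // nnegrE ?exprn_ge0 ?ler0n // ltW.
  by rewrite -natrX ler_nat.
have c2a : 0 < c ^+ (2 * a) by rewrite exprn_gt0.
by rewrite ler_ln // posrE // (lt_le_trans c2a).
Qed.

Theorem proposition8 (R : realType) (c : R) :
  1 < c ->
  (forall (gT : finGroupType) (A : {group gT}), abelian A ->
     ((log_base c (#|A|%:R))%:E < min_covering A R)%E) ->
  forall p : nat, prime p -> c ^+ 2 <= p%:R ->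
  forall n : nat, (1 <= n)%N ->
  forall M : 'M['F_p]_n, M \in unitmx ->
  exists x : 'cV['F_p]_n, nowhere_zero x /\ nowhere_zero (M *m x).
Proof.
move=> c1 gA p p_pr cp n _ M Mu.
pose good (x : 'cV['F_p]_n) := [forall i, (x i 0 != 0) && ((M *m x) i 0 != 0)].
have [/existsP[x /forallP x_good] | /existsPn bad] := boolP [exists x, good x].
  by exists x; split=> i; have /andP[] := x_good i.
pose hyp N (i : 'I_n) : {group 'cV['F_p]_n} := row_hyperplane_group N i.
pose C0 := (hyp 1%:M @: setT) :|: (hyp M @: setT).
have C0cov : subgroup_covering [set: 'cV['F_p]_n] C0.
  apply/subgroup_coveringP; split=> [H _|x _]; first exact: subsetT.
  have /forallPn[i] := bad x; rewrite negb_and !negbK => /orP[] xi0.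
    exists (hyp 1%:M i); first by rewrite inE imset_f ?inE.
    by rewrite inE mul1mx.
  by exists (hyp M i); rewrite ?inE ?imset_f ?inE ?orbT.
have [C Cmin CC0] := minset_exists C0cov.
have Cirr := minset_irredundant _ _ _ Cmin.
pose W := [group of \bigcap_(H in C) (H : {set 'cV['F_p]_n})].
have defW : \bigcap_(H in C) (H : {set _}) = W by [].
pose rows N := [set i | hyp N i \in C].
have Wrows N i : i \in rows N -> W \subset row_hyperplane N i.
  by rewrite inE => iC; rewrite -defW (bigcap_inf (hyp N i)).
(* Only an inequality holds in general, since a row of [M] may define a coordinate hyperplane. *)
have leC : (#|C| <= #|rows 1%:M| + #|rows M|)%N.
  pose D := (hyp 1%:M @: rows 1%:M) :|: (hyp M @: rows M).
  have /subset_leq_card/leq_trans-> // : C \subset D.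
    apply/subsetP => H HC; have := subsetP CC0 H HC.
    by case/setUP=> /imsetP[i _ defH]; apply/setUP; [left|right];
       rewrite defH imset_f // inE -defH.
  apply: leq_trans (leq_card_setU _ _) _.
  by apply: leq_add; apply: leq_imset_card.
have nW : [set: 'cV['F_p]_n] \subset ('N(W))%g.
  by rewrite sub_abelian_norm ?FinRing.zmod_abelian ?subsetT.
have abQ : abelian ([set: 'cV['F_p]_n] / W).
  by rewrite quotient_abelian ?FinRing.zmod_abelian.
have ltC := lt_le_trans (gA _ [group of ([set: 'cV['F_p]_n] / W)%g] abQ)
  (min_covering_quotient R _ [set: 'cV['F_p]_n]%G W C Cirr nW defW).
rewrite lte_fin in ltC.
(* Both matrices are invertible, so [2 a < k] and [2 b < k] follow separately from the same bound on
   [log_c #|V / W|]. *)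
have le_rows N : N \in unitmx -> (#|rows N|.*2 < #|C|)%N.
  move=> Nu; rewrite -(ltr_nat R); apply: le_lt_trans ltC.
  apply: (log_base_ge_double R c p) => //.
  have := card_quotient_row_hyperplanes _ _ _ W _ Nu (Wrows N).
  by rewrite card_Fp.
(* The sum gives [2 a + 2 b + 2 <= 2 k], against [k <= a + b]. *)
have := leq_add (le_rows _ (unitmx1 _ _)) (le_rows M Mu).
by rewrite leqNgt addSn addnS -doubleD addnn ltnS leqW // leq_double.
Qed.
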